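(* Let $(\mathcal X,d)$ be a metric space. Let $(H,d_H)$ be a compactly generated group with identity $e$ and metric $d_H$, and assume the length $g\mapsto d_H(e,g)$ is subadditive: $d_H(e,gh)\le d_H(e,g)+d_H(e,h)$. Assume that its metric balls have polynomial entropy of degree $D$: there is $C_H<\infty$ such that for all $R\ge0$ and $\delta>0$, $$N\big(B_H(e,R),d_H,\delta\big)\le C_H\Big(1+\frac R\delta\Big)^D .$$ Suppose $H$ acts on $\mathcal X$ through a homomorphism $\alpha:H\to C(\mathcal X,\mathcal X)$, and suppose there is a bounded set $S\subset H$ such that $F\subset\alpha(S)$. Finally assume there is $L_\alpha<\infty$ such that for all $g,h\in H$, $$d_\infty\big(\alpha(g),\alpha(h)\big)\le L_\alpha\,d_H(g,h).$$ Then there is a constant $C$ such that, for every $\varepsilon>0$ and $k\ge1$, $$N\big(B(k,F),d_\infty,\varepsilon\big)\le C\Big(1+\frac k\varepsilon\Big)^D .$$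
   Context: $C(\mathcal X,\mathcal X)$ is the monoid of continuous self-maps under composition; $d_\infty(f,g)=\sup_xd(f(x),g(x))$. An action through a homomorphism means $\alpha(gh)=\alpha(g)\circ\alpha(h)$ and $\alpha(e)=\mathrm{id}$. $B_H(e,R)=\{g\in H:d_H(e,g)\le R\}$. $B(k,F)$ is the set of all compositions of at most $k$ maps from $F$ (including the identity). $N(A,\rho,\varepsilon)$ is the covering number: the least number of open $\rho$-balls of radius $\varepsilon$, with centers in the ambient metric space, covering $A$. The constant $C$ does not depend on $\varepsilon$ or $k$. *)

(* Defs.v *)
From HB Require Import structures.
From mathcomp Require Import all_boot all_order all_algebra.
From mathcomp Require Import all_classical all_reals all_analysis.

Set Implicit Arguments.
Unset Strict Implicit.
Unset Printing Implicit Defensive.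

Import Order.TTheory GRing.Theory Num.Theory.
Import numFieldNormedType.Exports.

Local Open Scope classical_set_scope.
Local Open Scope ring_scope.
Local Open Scope ereal_scope.

HB.structure Definition PreTopologicalGroup := {G of Topological G & Group G}.

HB.mixin Record PreTopologicalGroup_isTopologicalGroup G
    & PreTopologicalGroup G := {
  mulg_continuous : continuous (fun x : G * G => (x.1 * x.2)%g) ;
  invg_continuous : continuous (fun x : G => x^-1%g)
}.

#[short(type="topologicalGroupType")]
HB.structure Definition TopologicalGroup :=
  {G of PreTopologicalGroup G & PreTopologicalGroup_isTopologicalGroup G}.

(* The topology is the one of the metric; no invariance of the metric is
   required. *)
#[short(type="metricGroupType")]
HB.structure Definition MetricGroup (K : numDomainType) :=
  {G of Metric K G & TopologicalGroup G}.

Definition subgroup (G : groupType) (A : set G) : Prop :=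
  A 1%g /\ forall x y, A x -> A y -> A (x / y)%g.

Definition compactly_generated (G : topologicalGroupType) : Prop :=
  exists2 K : set G, compact K & smallest (@subgroup G) K = [set: G].

Section self_maps.
Context {X : topologicalType}.
Implicit Types f g h : continuousType X X.

Definition cts_one : continuousType X X := idfun.
Definition cts_mul f g : continuousType X X := f \o g.

Lemma cts_mulA : associative cts_mul.
Proof. by move=> f g h; apply/continuousEP. Qed.

Lemma cts_mul1 : left_id cts_one cts_mul.
Proof. by move=> f; apply/continuousEP. Qed.

Lemma cts_mulr1 : right_id cts_one cts_mul.
Proof. by move=> f; apply/continuousEP. Qed.

HB.instance Definition _ :=
  isMonoid.Build (continuousType X X) cts_mulA cts_mul1 cts_mulr1.

(* Compositions of at most [k] maps from [F]; the empty one is the identity. *)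
Definition comp_ball (k : nat) (F : set (continuousType X X)) :
    set (continuousType X X) :=
  [set (\prod_(f <- s) f)%g | s in
    [set s : seq (continuousType X X) |
      (size s <= k)%N /\ forall f, f \in s -> F f]].

End self_maps.

(* The point [0] only matters when [X] is empty, where the supremum in
   [[0, +oo]] of the empty set is [0]. *)
Definition dinfty {R : realType} {X : metricType R}
    (f g : continuousType X X) : \bar R :=
  ereal_sup (0 |` [set (mdist (f x) (g x))%:E | x in [set: X]]).

Definition metric_bounded {R : realType} {T : metricType R} (A : set T) : Prop :=
  exists M : R, forall x y, A x -> A y -> (mdist x y <= M)%R.

(* [rho] is extended-valued so as to apply to [dinfty]; the value is [+oo] when
   there is no finite cover. *)
Definition covering_number {R : realType} {T : Type} (rho : T -> T -> \bar R)
    (A : set T) (e : R) : \bar R :=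
  ereal_inf [set n%:R%:E | n in
    [set n : nat | exists c : 'I_n -> T,
      A `<=` \bigcup_i [set x | rho (c i) x < e%:E]]].

Definition emdist {R : realType} {T : metricType R} (x y : T) : \bar R :=
  (mdist x y)%:E.

Definition length_ball {R : realType} (H : metricGroupType R) (r : R) : set H :=
  [set g | (mdist (1%g : H) g <= r)%R].
Arguments length_ball {R} H r.

Definition polynomial_entropy {R : realType} (H : metricGroupType R) (D : R)
    : Prop :=
  exists CH : R, forall r delta : R, (0 <= r)%R -> (0 < delta)%R ->
    covering_number emdist (length_ball H r) delta
      <= (CH * (1 + r / delta) `^ D)%:E.

(* Main.v *)
Require Import Defs.
From HB Require Import structures.
From mathcomp Require Import all_boot all_order all_algebra.
From mathcomp Require Import all_classical all_reals all_analysis.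

(** A product of at most [k] maps of [F] is the image under [alpha] of an element
    of length at most [k * M], where [M] bounds the length on [S].  Hence
    [B(k, F)] lies in the image of a metric ball of [H], and the Lipschitz map
    [alpha] carries covers of that ball to covers of the image, changing the
    radius by a constant factor. *)

Import Order.TTheory GRing.Theory Num.Theory.
Import numFieldNormedType.Exports.

Local Open Scope classical_set_scope.
Local Open Scope ring_scope.

(** The centers of a cover of [A] are pushed forward by [f]. They may lie outside [A], since [f] is
    defined on all of [T]. *)
Lemma covering_number_image (R : realType) (T U : Type)
    (rho : T -> T -> \bar R) (sigma : U -> U -> \bar R) (f : T -> U)
    (A : set T) (B : set U) (d e : R) :
  B `<=` f @` A ->
  (forall x y, (rho x y < d%:E)%E -> (sigma (f x) (f y) < e%:E)%E) ->
  (covering_number sigma B e <= covering_number rho A d)%E.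
Proof.
move=> BA fP; apply: ereal_inf_le_tmp => _ [n [c Ac] <-].
exists n => //; exists (f \o c) => _ /BA[x /Ac[i _ cix] <-].
by exists i => //; exact: fP.
Qed.

(** The maximum treats both signs of [D]: if [D >= 0], use [1 + c * t <= c * (1 + t)]; if [D < 0],
    the power is nonincreasing and [1 + t <= 1 + c * t]. *)
Lemma powR_dilation (R : realType) (D c t : R) : 1 <= c -> 0 <= t ->
  (1 + c * t) `^ D <= Num.max 1 (c `^ D) * (1 + t) `^ D.
Proof.
move=> c1 t0; have c0 : 0 <= c by apply: le_trans c1.
have t1 : 0 < 1 + t by rewrite ltr_wpDr.
have tct : 1 + t <= 1 + c * t by rewrite lerD2l ler_peMl.
have [D0|D0] := leP 0 D.
  apply: (@le_trans _ _ (c `^ D * (1 + t) `^ D)); last first.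
    by rewrite ler_wpM2r ?powR_ge0// le_max lexx orbT.
  rewrite -powRM ?(ltW t1)//; apply: ge0_ler_powR => //.
  - by rewrite nnegrE addr_ge0 ?mulr_ge0.
  - by rewrite nnegrE mulr_ge0 ?(ltW t1).
  - by rewrite mulrDr mulr1 lerD2r.
apply: (@le_trans _ _ ((1 + t) `^ D)); last first.
  by rewrite ler_peMl ?powR_ge0// le_max lexx.
(* As [D < 0], both powers are inverses of powers with exponent [- D > 0], which reverses the
   comparison. *)
rewrite -[D]opprK !(powRN _ (- D)) lef_pV2 ?posrE ?powR_gt0//; last first.
  exact: lt_le_trans tct.
apply: ge0_ler_powR => //; first by rewrite oppr_ge0 ltW.
  by rewrite nnegrE ltW.
by rewrite nnegrE ltW// (lt_le_trans t1).
Qed.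

(** Boundedness only compares points of [A], so the distance from an outside point [x] is estimated
    through a fixed [z] in [A]. *)
Lemma metric_bounded_le (R : realType) (T : metricType R) (A : set T) (x : T) :
  metric_bounded A -> exists2 M : R, 0 <= M & forall y, A y -> mdist x y <= M.
Proof.
move=> [M AM]; have [->|/set0P[z Az]] := eqVneq A set0; first by exists 0 => // y [].
exists (mdist x z + Num.max 0 M) => [|y Ay].
  by rewrite addr_ge0 ?mdist_ge0 ?le_max ?lexx.
by rewrite (le_trans (metric_triangle x z y))// lerD2l le_max AM// orbT.
Qed.

Lemma comp_ball_sub_length_ball (R : realType) (X : metricType R)
    (H : metricGroupType R) (alpha : H -> continuousType X X)
    (F : set (continuousType X X)) (S : set H) (M : R) (k : nat) :
  (forall g h : H,
    mdist (1%g : H) (g * h)%g <= mdist (1%g : H) g + mdist (1%g : H) h) ->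
  monoid.monoid_morphism alpha -> F `<=` alpha @` S -> 0 <= M ->
  (forall g, S g -> mdist (1%g : H) g <= M) ->
  comp_ball k F `<=` alpha @` length_ball H (k%:R * M).
Proof.
move=> subadd [a1 aM] FS M0 SM _ [s [sk sF] <-].
(* The bound is stated with the exact length of the word, so that induction adds one [M] per letter
   by subadditivity. *)
suff [g gs <-] : exists2 g : H, mdist (1%g : H) g <= (size s)%:R * M &
    alpha g = (\prod_(f <- s) f)%g.
  by exists g => //; apply: (le_trans gs); rewrite ler_wpM2r// ler_nat.
elim: s sF {sk} => [_|f s IH sF].
  by exists 1%g; rewrite ?big_nil// mdistxx mul0r.
have [|g gs gE] := IH; first by move=> h hs; apply: sF; rewrite inE hs orbT.
have [h Sh hE] := FS f (sF f (mem_head _ _)).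
exists (h * g)%g; last by rewrite big_cons aM hE gE.
by rewrite (le_trans (subadd _ _))//= -natr1 mulrDl mul1r addrC lerD// SM.
Qed.

Theorem mainTheorem6 (R : realType) (X : metricType R) (H : metricGroupType R)
    (D : R) (alpha : H -> continuousType X X) (F : set (continuousType X X))
    (H_cg : compactly_generated H)
    (H_subadditive : forall g h : H,
      mdist (1%g : H) (g * h)%g <= mdist (1%g : H) g + mdist (1%g : H) h)
    (H_entropy : polynomial_entropy H D)
    (alpha_hom : monoid.monoid_morphism alpha)
    (F_alpha : exists2 S : set H, metric_bounded S & F `<=` alpha @` S)
    (alpha_lip : exists L : R, forall g h : H,
      (dinfty (alpha g) (alpha h) <= (L * mdist g h)%:E)%E) :
  exists C : R, forall (eps : R) (k : nat), 0 < eps -> (1 <= k)%N ->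
    (covering_number dinfty (comp_ball k F) eps
      <= (C * (1 + k%:R / eps) `^ D)%:E)%E.
Proof.
have [S /(metric_bounded_le _ _ _ (1%g : H))[M M0 SM] FS] := F_alpha.
have [CH HCH] := H_entropy; have [L aL] := alpha_lip.
(* Enlarging both constants to at least 1 allows division by [L'] and gives the dilation factor
   [c >= 1]. *)
pose L' := Num.max 1 L; pose M' := Num.max 1 M.
have L1 : 1 <= L' by rewrite le_max lexx.
have M1 : 1 <= M' by rewrite le_max lexx.
have L0 : 0 < L' by exact: lt_le_trans L1.
pose c := M' * L'.
have c1 : 1 <= c by rewrite mulr_ege1.
(* Nonnegativity lets this factor multiply the inequality between powers. *)
pose CH' := Num.max 0 CH.
exists (CH' * Num.max 1 (c `^ D)) => eps k eps0 _.
have kM0 : 0 <= k%:R * M' by rewrite mulr_ge0// (le_trans _ M1).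
have d0 : 0 < eps / L' by rewrite divr_gt0.
have sub : comp_ball k F `<=` alpha @` length_ball H (k%:R * M').
  apply: (comp_ball_sub_length_ball _ _ _ _ _ _ _ _ _ _ FS) => //.
    by rewrite (le_trans _ M1).
  by move=> g /SM gM; rewrite le_max gM orbT.
(* Points of [H] closer than [eps / L'] have images closer than [eps]. *)
apply: (le_trans (covering_number_image _ _ _ emdist _ _ _ _ (eps / L') _ sub _)).
  move=> g h; rewrite lte_fin ltr_pdivlMr// => gh.
  apply: (le_lt_trans (aL g h)); rewrite lte_fin (le_lt_trans _ gh)//.
  by rewrite mulrC ler_wpM2l ?mdist_ge0// le_max lexx orbT.
apply: (le_trans (HCH _ _ kM0 d0)); rewrite lee_fin.
have -> : k%:R * M' / (eps / L') = c * (k%:R / eps).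
  by rewrite invf_div /c [k%:R * M']mulrC mulrACA.
rewrite -[leRHS]mulrA; apply: (@le_trans _ _ (CH' * (1 + c * (k%:R / eps)) `^ D)).
  by rewrite ler_wpM2r ?powR_ge0// le_max lexx orbT.
rewrite ler_wpM2l ?le_max ?lexx//.
by apply: powR_dilation => //; rewrite divr_ge0// ltW.
Qed.
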